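(* Let $\Omega\subset\mathbb{R}^n$ be an open and bounded set with Lipschitz boundary, and let $\lambda\in\mathbb{R}$. Let $\mu>0$, $s\in(0,1)$, $1<p^-<p^+<\infty$, and let $G$ be a Young function with $G'=g$ satisfying $$p^-\leq \frac{t g(t)}{G(t)}\leq p^+\qquad\text{for all } t>0,$$ with $sp^+<n$ and $p^+\le \frac{np^-}{n-sp^-}$ (the Sobolev conjugate of $p^-$). Then there exists a constant $C_0=C_0(n,s,p^\pm,\mu)>0$ such that if $u\in W^{s,G}_0(\Omega)$ is a weak solution of $$(-\Delta_g)^s u=\lambda g(u)\ \text{ in }\Omega,\qquad u=0\ \text{ in }\mathbb{R}^n\setminus\Omega,$$ with $\int_\Omega G(|u|)\,dx=\mu$, then $u$ is bounded in $\Omega$ with $$\|u\|_{L^\infty(\Omega)}\leq C_0.$$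
   Context: A Young function is a function $G:[0,\infty)\to[0,\infty)$ of the form $G(t)=\int_0^t g(\tau)\,d\tau$, where $g$ is right-continuous on $[0,\infty)$, $g(0)=0$, $g(t)>0$ for $t>0$, $g$ is nondecreasing on $(0,\infty)$, and $\lim_{t\to\infty}g(t)=\infty$. Young functions are normalized by $G(1)=1$ and extended evenly, $G(-t)=G(t)$ (so $g=G'$ is extended as an odd function). For measurable $u:\mathbb{R}^n\to\mathbb{R}$ put $D_su(x,y)=\frac{u(x)-u(y)}{|x-y|^s}$, $\Phi_G(u)=\int_\Omega G(|u|)\,dx$, and $\Phi_{s,G}(u)=\iint_{\mathbb{R}^n\times\mathbb{R}^n}G(|D_su|)\,\frac{dx\,dy}{|x-y|^n}$. Then $W^{s,G}(\Omega)$ is the set of measurable $u:\mathbb{R}^n\to\mathbb{R}$ with $\Phi_{s,G}(u)+\Phi_G(u)<\infty$, and $W^{s,G}_0(\Omega)=\{u\in W^{s,G}(\Omega): u=0 \text{ a.e. in }\mathbb{R}^n\setminus\Omega\}$. The fractional $g$-Laplacian is $(-\Delta_g)^su(x)=\text{p.v.}\int_{\mathbb{R}^n} g(D_su(x,y))\frac{dy}{|x-y|^{n+s}}$. A function $u\in W^{s,G}_0(\Omega)$ is a weak solution of the problem in the claim if for every $v\in W^{s,G}_0(\Omega)$ $$\iint_{\mathbb{R}^n\times\mathbb{R}^n} g\left(\frac{u(x)-u(y)}{|x-y|^s}\right)\frac{v(x)-v(y)}{|x-y|^{n+s}}\,dx\,dy=\lambda\int_\Omega g(u)v\,dx.$$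 Notation $C=C(a,b,\dots)$ means a constant depending on the listed quantities; $p^\pm$ stands for the pair $p^-,p^+$.
   Formalization: The constant C_0 is allowed to depend on λ as well as on n, s, p^±, μ; independence of λ is false, since scaling an eigenfunction (G(t)=t^2) to small domains keeps μ fixed while its sup norm blows up. *)

(* Defs.v *)
From HB Require Import structures.
From mathcomp Require Import all_boot all_order all_algebra.
From mathcomp Require Import all_classical all_reals all_analysis.

Set Implicit Arguments.
Unset Strict Implicit.
Unset Printing Implicit Defensive.
Import Order.TTheory GRing.Theory Num.Theory.
Import numFieldNormedType.Exports.
Local Open Scope classical_set_scope.
Local Open Scope ring_scope.

Definition rV_display : measure_display.
Proof. exact: default_measure_display. Qed.

(* The Borel sigma-algebra of R^n, generated by the coordinate projections. *)
Section measurable_rV.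
Context {R : realType} (n : nat).

Let coord (i : 'I_n) (x : 'rV[R]_n) : measurableTypeR R := x ord0 i.

Let rV_set0 : g_sigma_preimage coord set0.
Proof. exact: sigma_algebra0. Qed.

Let rV_setC A : g_sigma_preimage coord A -> g_sigma_preimage coord (~` A).
Proof. exact: sigma_algebraC. Qed.

Let rV_bigcup (F : _^nat) : (forall i, g_sigma_preimage coord (F i)) ->
  g_sigma_preimage coord (\bigcup_i (F i)).
Proof. exact: sigma_algebra_bigcup. Qed.

HB.instance Definition _ := @isMeasurable.Build rV_display
  'rV[R]_n (g_sigma_preimage coord) rV_set0 rV_setC rV_bigcup.

Lemma measurable_coord (i : 'I_n) :
  measurable_fun [set: 'rV[R]_n] (fun x => x ord0 i : measurableTypeR R).
Proof.
move=> _ Y mY; rewrite setTI; apply: sub_sigma_algebra => /=.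
rewrite -bigcup_seq/=; exists i => /=; first by rewrite mem_index_enum.
by exists Y => //; rewrite setTI.
Qed.

Lemma measurable_fun_coordP d (T : measurableType d) (f : T -> 'rV[R]_n) :
  (forall i, measurable_fun [set: T] (fun x => f x ord0 i : measurableTypeR R)) ->
  measurable_fun [set: T] f.
Proof.
move=> mf _ Y; rewrite setTI => mY; rewrite -[_ @^-1` _]setTI.
move: Y mY; apply: smallest_sub.
  split => [|A mA|F mF]; rewrite /= ?setTI.
  - by rewrite preimage_set0.
  - by rewrite setTD -preimage_setC; apply: measurableC; rewrite -[_ @^-1` _]setTI.
  - rewrite preimage_bigcup; apply: bigcupT_measurable => i.
    by rewrite -[_ @^-1` _]setTI; exact: mF.
move=> A; rewrite -bigcup_seq => -[i _] [B mB <-] /=.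
by rewrite setTI; exact: mf.
Qed.

End measurable_rV.

Section lebesgue_rV.
Context {R : realType}.

Definition consrV n (p : measurableTypeR R * 'rV[R]_n) : 'rV[R]_n.+1 :=
  row_mx (const_mx p.1 : 'rV[R]_1) p.2.

Lemma consrV0 n (p : measurableTypeR R * 'rV[R]_n) : consrV p ord0 ord0 = p.1.
Proof. by rewrite mxE; case: splitP => // j _; rewrite mxE. Qed.

Lemma consrVS n (p : measurableTypeR R * 'rV[R]_n) i :
  consrV p ord0 (lift ord0 i) = p.2 ord0 i.
Proof.
rewrite mxE; case: splitP => [j|k /= /eqP]; first by rewrite ord1.
by rewrite eqSS => /eqP/val_inj ->.
Qed.

Lemma measurable_consrV n : measurable_fun setT (@consrV n).
Proof.
apply: measurable_fun_coordP => i.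
have [j ->|->] := unliftP ord0 i.
- under eq_fun do rewrite consrVS.
  exact: (measurableT_comp (measurable_coord j) measurable_snd).
- under eq_fun do rewrite consrV0.
  exact: measurable_fst.
Qed.

Section step.
Local Open Scope ereal_scope.
Variables (n : nat) (mu : {sigma_finite_measure set 'rV[R]_n -> \bar R}).

Definition lebesgue_consrV : set 'rV[R]_n.+1 -> \bar R :=
  pushforward (lebesgue_measure \x mu) (@consrV n).

Let mconsrV A : measurable A -> measurable (@consrV n @^-1` A).
Proof. by move=> mA; rewrite -[_ @^-1` _]setTI; exact: measurable_consrV. Qed.

Let step0 : lebesgue_consrV set0 = 0.
Proof. by rewrite /lebesgue_consrV /pushforward preimage_set0 measure0. Qed.

Let step_ge0 A : 0 <= lebesgue_consrV A.
Proof. by rewrite /lebesgue_consrV /pushforward; exact: measure_ge0. Qed.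

Let step_sigma_additive : semi_sigma_additive lebesgue_consrV.
Proof.
move=> F mF tF mUF; rewrite /lebesgue_consrV /pushforward preimage_bigcup.
apply: measure_semi_sigma_additive.
- by move=> k; exact: mconsrV.
- apply/trivIsetP => /= i j _ _ ij; rewrite -preimage_setI.
  by move/trivIsetP : tF => /(_ _ _ _ _ ij) ->//; rewrite preimage_set0.
- by rewrite -preimage_bigcup; exact: mconsrV.
Qed.

HB.instance Definition _ := isMeasure.Build _ _ _ lebesgue_consrV
  step0 step_ge0 step_sigma_additive.

Let unconsrV (x : 'rV[R]_n.+1) : measurableTypeR R * 'rV[R]_n :=
  (x ord0 ord0, \row_i x ord0 (lift ord0 i)).

Let unconsrVK : cancel unconsrV (@consrV n).
Proof.
move=> x; apply/rowP => i; have [j ->|->] := unliftP ord0 i.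
- by rewrite consrVS mxE.
- by rewrite consrV0.
Qed.

Let consrVK : cancel (@consrV n) unconsrV.
Proof.
move=> [a v]; rewrite /unconsrV consrV0; congr pair.
by apply/rowP => i; rewrite mxE consrVS.
Qed.

Let measurable_unconsrV : measurable_fun setT unconsrV.
Proof.
apply: measurable_fun_pair; first exact: measurable_coord.
apply: measurable_fun_coordP => i; under eq_fun do rewrite mxE.
exact: measurable_coord.
Qed.

Let step_sigma_finite : sigma_finite setT lebesgue_consrV.
Proof.
have /sigma_finiteP[F [TF ndF Foo]] := sigma_finiteT (@lebesgue_measure R).
have /sigma_finiteP[H [TH ndH Hoo]] := sigma_finiteT mu.
exists (fun k => unconsrV @^-1` (F k `*` H k)).
  rewrite -preimage_bigcup; apply/esym/seteqP; split => // x _ /=.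
  have [i _ Fi] : (\bigcup_i F i) (unconsrV x).1 by rewrite -TF.
  have [j _ Hj] : (\bigcup_i H i) (unconsrV x).2 by rewrite -TH.
  exists (maxn i j) => //; split.
  - by apply: (subsetPset _ _ (ndF _ _ (leq_maxl i j))).
  - by apply: (subsetPset _ _ (ndH _ _ (leq_maxr i j))).
move=> k; have [? ?] := Foo k; have [? ?] := Hoo k; split.
  rewrite -[_ @^-1` _]setTI; apply: measurable_unconsrV => //.
  exact: measurableX.
rewrite /lebesgue_consrV /pushforward -comp_preimage.
rewrite (_ : unconsrV \o @consrV n = id); last by apply/funext => p; exact: consrVK.
by rewrite preimage_id product_measure1E// lte_mul_pinfty// ge0_fin_numE.
Qed.

HB.instance Definition _ := Measure_isSigmaFinite.Build _ _ _ lebesgue_consrV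
  step_sigma_finite.

Lemma lebesgue_consrVE (A : set (measurableTypeR R)) (B : set 'rV[R]_n) :
  measurable A -> measurable B ->
  lebesgue_consrV [set x | A (x ord0 ord0) /\ B (\row_i x ord0 (lift ord0 i))] =
  lebesgue_measure A * mu B.
Proof.
move=> mA mB; rewrite -product_measure1E// /lebesgue_consrV /pushforward.
congr (_ _); apply/seteqP; split => -[a v] /=; rewrite consrV0;
  by rewrite (_ : \row_i _ = v)//; apply/rowP => i; rewrite mxE consrVS.
Qed.

End step.

(* Lebesgue measure on R^n as an n-fold product: a point mass when n = 0, and
   the image of lebesgue_measure \x (Lebesgue measure on R^n) under the
   identification of R * R^n with R^(n+1) otherwise. *)
Fixpoint lebesgue_rV n : {sigma_finite_measure set 'rV[R]_n -> \bar R} :=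
  match n with
  | 0 => \d_(0 : 'rV[R]_0)
  | k.+1 => lebesgue_consrV (lebesgue_rV k)
  end.

Lemma lebesgue_rV_box n (a b : 'rV[R]_n) : (forall i, a ord0 i <= b ord0 i) ->
  lebesgue_rV n [set x | forall i, a ord0 i < x ord0 i <= b ord0 i] =
  (\prod_(i < n) (b ord0 i - a ord0 i))%:E.
Proof.
elim: n a b => [|n IH] a b ab.
  by rewrite big_ord0 /= diracE mem_set// => -[].
have mbox k (c d : 'rV[R]_k) :
    measurable [set x : 'rV[R]_k | forall i, c ord0 i < x ord0 i <= d ord0 i].
  rewrite (_ : [set x : 'rV[R]_k | _] =
    \bigcap_(i in [set: 'I_k])
      ((fun x : 'rV[R]_k => x ord0 i) @^-1` `]c ord0 i, d ord0 i])).
    apply: fin_bigcap_measurable => // i _; rewrite -[_ @^-1` _]setTI.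
    by apply: (measurable_coord i) => //; exact: measurable_itv.
  apply/seteqP; split => x /= cd i => [_|]; first by rewrite /= in_itv/= cd.
  by have := cd i I; rewrite /= in_itv.
pose a' := \row_i a ord0 (lift ord0 i); pose b' := \row_i b ord0 (lift ord0 i).
rewrite big_ord_recl EFinM.
have /= <- : lebesgue_measure
    (`]a ord0 ord0, b ord0 ord0]%classic : set (measurableTypeR R)) =
    (b ord0 ord0 - a ord0 ord0)%:E.
  rewrite lebesgue_measure_itv/= lte_fin; case: ltP => // ba.
  by rewrite (@le_anti _ _ (a ord0 ord0) (b ord0 ord0)) ?subrr// ab.
rewrite (_ : \prod_(i < n) _ = \prod_(i < n) (b' ord0 i - a' ord0 i)); last first.
  by apply: eq_bigr => i _; rewrite !mxE.
rewrite -IH; last by move=> i; rewrite !mxE.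
rewrite -lebesgue_consrVE//; last exact: mbox.
congr (lebesgue_consrV _ _); apply/seteqP; split => x /=.
  by move=> abx; split => [|i]; [rewrite in_itv/=|rewrite !mxE].
move=> [+ abx] i; have [j ->|->] := unliftP ord0 i; last by rewrite in_itv.
by have := abx j; rewrite !mxE.
Qed.

End lebesgue_rV.

Section euclidean.
Context {R : realType} (n : nat).

Definition dotv (x y : 'rV[R]_n) : R := \sum_i x ord0 i * y ord0 i.

(* `|x| on 'rV is the sup norm; it has the same open and bounded sets, but the
   kernels below involve the Euclidean norm. *)
Definition enorm (x : 'rV[R]_n) : R := Num.sqrt (dotv x x).

(* Near each of its boundary points, Omega is the strict epigraph, in the
   direction of a unit vector nu, of a Lipschitz function of the component
   orthogonal to nu. (Taking gamma on all of R^n instead of on the hyperplane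
   nu^perp only matters up to composing with the orthogonal projection.) *)
Definition lipschitz_boundary (Omega : set 'rV[R]_n) : Prop :=
  forall x0, (closure Omega `\` Omega°) x0 ->
  exists (nu : 'rV[R]_n) (gamma : 'rV[R]_n -> R) (L r : R),
    [/\ dotv nu nu = 1,
        forall y z, `|gamma y - gamma z| <= L * enorm (y - z),
        0 < r &
        forall x, enorm (x - x0) < r ->
          (Omega x <-> gamma (x - dotv x nu *: nu) < dotv x nu)].

End euclidean.

(* Both functions live on the whole line: G is extended evenly and g oddly. *)
Record young_function {R : realType} (G g : R -> R) : Prop := {
  young_integral : forall t : R, 0 <= t ->
    G t = \int[@lebesgue_measure R]_(tau in `[0, t]) g tau;
  young_right_cts : forall t : R, 0 <= t -> g x @[x --> t^'+] --> g t;
  young_g0 : g 0 = 0;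
  young_gt0 : forall t : R, 0 < t -> 0 < g t;
  young_nondecreasing : forall t t' : R, 0 < t -> t <= t' -> g t <= g t';
  young_cvg : g t @[t --> +oo] --> +oo;
  young_normalized : G 1 = 1;
  young_even : forall t : R, G (- t) = G t;
  young_odd : forall t : R, g (- t) = - g t }.

Section fractional_orlicz_sobolev.
Local Open Scope ereal_scope.
Context {R : realType} (n : nat).
Implicit Types (s : R) (G g : R -> R) (Omega : set 'rV[R]_n)
  (u v : 'rV[R]_n -> R).

(* Division by zero gives 0, so this and the integrands below vanish on the
   diagonal, a null set. *)
Definition hoelder_quot s u (x y : 'rV[R]_n) : R :=
  ((u x - u y) / enorm (x - y) `^ s)%R.

Definition Phi G Omega u : \bar R :=
  \int[lebesgue_rV n]_(x in Omega) (G `|u x|%R)%:E.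

Definition Phis s G u : \bar R :=
  \int[lebesgue_rV n \x lebesgue_rV n]_z
    (G `|hoelder_quot s u z.1 z.2| / enorm (z.1 - z.2) ^+ n)%R%:E.

Definition WsG s G Omega u : Prop :=
  measurable_fun setT (u : 'rV[R]_n -> measurableTypeR R) /\
  Phis s G u + Phi G Omega u < +oo.

Definition WsG0 s G Omega u : Prop :=
  WsG s G Omega u /\ \forall x \ae lebesgue_rV n, ~ Omega x -> u x = 0%R.

(* Weak solutions of (-Delta_g)^s u = lambda g(u) in Omega, u = 0 outside. *)
Definition weak_solution s G g Omega (lambda : R) u : Prop :=
  WsG0 s G Omega u /\
  forall v, WsG0 s G Omega v ->
    \int[lebesgue_rV n \x lebesgue_rV n]_z
      (g (hoelder_quot s u z.1 z.2) *
        ((v z.1 - v z.2) / enorm (z.1 - z.2) `^ (n%:R + s)))%R%:E =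
    lambda%:E * \int[lebesgue_rV n]_(x in Omega) (g (u x) * v x)%R%:E.

End fractional_orlicz_sobolev.

(* Main.v *)
Require Import Defs.
From mathcomp Require Import all_boot all_order all_algebra.
From mathcomp Require Import all_classical all_reals all_analysis.
From mathcomp Require Import measurable_realfun ess_sup_inf ring lra.
Import Order.TTheory GRing.Theory Num.Theory.
Import numFieldNormedType.Exports.
Local Open Scope classical_set_scope.
Local Open Scope ring_scope.

(** The bound comes from a De Giorgi iteration over the levels
    [M * (1 - 2 ^- k)], run on the modular [Phi G Omega] of the excesses
    (u - c)_+ = [excess c u].

    Testing the equation with (u - c)_+ is legitimate, and since g is
    nondecreasing it bounds the nonlocal energy of the excess by the reaction
    term: [energy_excess].  The reaction term at a level is in turn bounded, by
    doubling, by the modular of the excess over the previous level: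
    [reaction_le].

    The gain in each step is an elementary Poincare inequality.  If w vanishes
    outside a set of measure at most r^n, then around each point a cube of side
    2r contains a set of measure at least r^n where w = 0, and the part of the
    double integral over these pairs already dominates the modular of w, up to
    a factor of order r^s: [small_support_poincare].  The superlevel sets are
    small by Chebyshev's inequality, [excess_support_le], so
    [degiorgi_step] contracts, and for M large the modulars decay geometrically:
    [Phi_excess_decay].  Hence (u - M)_+ = 0 almost everywhere in Omega,
    and the same applied to -u bounds |u|.

    The growth of G enters through convexity, through [t * g t <= pp * G t], and
    through the doubling inequality [G (2 ^+ k * t) <= K ^+ k * G t] that follows
    from both, with K a function of pp; the normalization [G 1 = 1] fixes the
    scale of M.  All constants are therefore uniform in G and Omega. *)

(** * Growth of Young functions *)

Section young.
Context {R : realType}.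
Variables (G g : R -> R) (pm pp : R).
Hypothesis Y : young_function G g.
Hypothesis pp_gt1 : 1 < pp.
Hypothesis ratio : forall t : R, 0 < t -> pm <= t * g t / G t <= pp.

Lemma young_deriv_mono (a b : R) : a <= b -> g a <= g b.
Proof.
move=> ab; have [a0|a0|a0] := ltgtP 0 a.
- exact: (young_nondecreasing Y).
- have [b0|b0|b0] := ltgtP 0 b.
  + rewrite (@le_trans _ _ 0)//; last exact: ltW (young_gt0 Y b0).
    rewrite -(opprK a) (young_odd Y) oppr_le0 ltW// (young_gt0 Y)//; lra.
  + rewrite -lerN2 -!(young_odd Y).
    apply: (young_nondecreasing Y); lra.
  + rewrite -b0 (young_g0 Y).
    rewrite -(opprK a) (young_odd Y) oppr_le0 ltW// (young_gt0 Y)//; lra.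
- have [->|b0] := eqVneq b 0; first by rewrite -a0.
  rewrite -a0 (young_g0 Y) ltW// (young_gt0 Y)// lt_neqAle eq_sym b0/=; lra.
Qed.

Lemma young_deriv_ge0 (t : R) : 0 <= t -> 0 <= g t.
Proof. by move=> t0; rewrite -(young_g0 Y); exact: young_deriv_mono. Qed.

Lemma measurable_young_deriv : measurable_fun setT (g : R -> R).
Proof.
by apply: nondecreasing_measurable => // x y; exact: young_deriv_mono.
Qed.

Let itg (a b : R) (i1 i2 : bool) :
  (@lebesgue_measure R).-integrable [set` Interval (BSide i1 a) (BSide i2 b)]
    (EFin \o g).
Proof.
apply: measurable_bounded_integrable => //=.
- have := @measurable_itv R (Interval (BSide i1 a) (BSide i2 b)) => //.
- rewrite lebesgue_measure_itv/=; by case: ifPn => _; rewrite ?ltry// -EFinB ltry.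
- exact: measurable_funS measurable_young_deriv.
- exists (Num.max (g b) (- g a)); split; rewrite ?num_real// => M abM x /= xab.
  have /andP[ax xb] : a <= x <= b.
    move: xab; rewrite in_itv/=; case: i1; case: i2 => /=; lra.
  move: abM; rewrite gt_max => /andP[bM aM].
  have := young_deriv_mono _ _ ax; have := young_deriv_mono _ _ xb.
  by rewrite ler_norml; lra.
Qed.

(** G is convex with subgradient g.  All growth properties of G used below
    come from these two rectangle bounds. *)
Lemma young_increment (a b : R) : 0 <= a -> a <= b ->
  (b - a) * g a <= G b - G a <= (b - a) * g b.
Proof.
move=> a0 ab; rewrite !(young_integral Y)//; last exact: le_trans ab.
rewrite Rintegral_itvB ?bnd_simp//.
have cst_int (c : R) : \int[@lebesgue_measure R]_(x in `]a, b]) c = (b - a) * c.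
  rewrite Rintegral_cst//= lebesgue_measure_itv/= lte_fin mulrC.
  case: ltP => // ba; rewrite (_ : b - a = 0)//; lra.
have icst (c : R) : (@lebesgue_measure R).-integrable `]a, b] (EFin \o cst c).
  apply: measurable_bounded_integrable => //=.
  - rewrite lebesgue_measure_itv/=; by case: ifPn => _; rewrite ?ltry// -EFinB ltry.
  - exact: bounded_cst.
rewrite -!cst_int; apply/andP; split; apply: le_Rintegral => //=;
  try (exact: icst || exact: itg); move=> x /=; rewrite in_itv/= => /andP[? ?];
  by apply: young_deriv_mono => //; exact: ltW.
Qed.

Lemma young0 : G 0 = 0.
Proof. by rewrite (young_integral Y)// set_itv1 Rintegral_set1. Qed.

Lemma young_le (a b : R) : 0 <= a -> a <= b -> G a <= G b.
Proof.
move=> a0 ab; have /andP[+ _] := young_increment _ _ a0 ab.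
have := young_deriv_ge0 _ a0; nra.
Qed.

Lemma young_ge0 (t : R) : 0 <= G t.
Proof.
have [t0|t0] := leP 0 t; first by rewrite -young0 young_le.
by rewrite -(opprK t) (young_even Y) -young0 young_le//; lra.
Qed.

Lemma young_abs (t : R) : G `|t| = G t.
Proof. by case: ger0P => // _; exact: young_even Y t. Qed.

Lemma young_pos (t : R) : 0 < t -> 0 < G t.
Proof.
move=> t0; have h0 : 0 < t / 2 by lra.
have /andP[+ _] := young_increment (t / 2) t ltac:(lra) ltac:(lra).
have := young_gt0 Y h0; have := young_ge0 (t / 2); nra.
Qed.

Lemma measurable_young : measurable_fun setT (G : R -> R).
Proof.
have -> : G = (fun t => G (Num.max t 0)) \o Num.norm.
  by apply/funext => t /=; rewrite max_l// young_abs.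
apply: measurableT_comp => //; apply: nondecreasing_measurable => // x y xy /=.
apply: young_le; first by rewrite le_max lexx orbT.
by rewrite ge_max !le_max xy lexx orbT.
Qed.

Lemma young_le_deriv (t : R) : 0 <= t -> G t <= t * g t.
Proof.
move=> t0; have /andP[_] := young_increment 0 t (lexx _) t0.
by rewrite young0 !subr0.
Qed.

Lemma young_deriv_le (t : R) : 0 <= t -> t * g t <= pp * G t.
Proof.
rewrite le_eqVlt => /predU1P[<-|t0]; first by rewrite young0 mul0r mulr0.
by have /andP[_] := ratio t t0; rewrite ler_pdivrMr// young_pos.
Qed.

Lemma young_scale (a t : R) : 1 <= a -> 0 <= t -> a * G t <= G (a * t).
Proof.
move=> a1 t0; have /andP[+ _] := young_increment t (a * t) t0 ltac:(nra).
have := young_le_deriv t t0; nra.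
Qed.

(** With b the argument on the left, the increment of G over [t, b] is at most
    [(b - t) * g b <= pp * (b - t) / b * G b], and the factor
    [1 + (2 * pp)^-1] is chosen so that this is at most half of [G b]. *)
Lemma young_short_doubling (t : R) : 0 <= t ->
  G ((1 + (2 * pp)^-1) * t) <= 2 * G t.
Proof.
move=> t0; have pp0 : 0 < pp by rewrite (lt_trans _ pp_gt1).
set e := (2 * pp)^-1.
have e0 : 0 < e by rewrite invr_gt0 mulr_gt0.
have epp : e * pp = 1 / 2 by rewrite /e; field; rewrite gt_eqF.
clearbody e; set b := (1 + e) * t.
have bt : b - t = e * t by rewrite /b; ring.
have et0 : 0 <= e * t by rewrite mulr_ge0// ltW.
have tb : t <= b by lra.
have b0 : 0 <= b by exact: le_trans tb.
have /andP[_] := young_increment t b t0 tb; rewrite bt.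
have := young_deriv_le b b0; have := young_deriv_ge0 b b0; have := young_ge0 b.
move=> Gb gb kb h.
have : e * t * g b <= e * (pp * G b).
  rewrite -mulrA ler_pM2l//; apply: le_trans kb.
  by rewrite ler_wpM2r.
rewrite mulrA epp; lra.
Qed.

End young.

(** Finitely many short doublings make a doubling.  Their number depends on the
    upper exponent only, which is why K is quantified before G. *)
Lemma young_doubling {R : realType} (pp : R) : 1 < pp ->
  exists2 K : R, 2 <= K & forall (G g : R -> R) (pm : R),
    young_function G g -> (forall t, 0 < t -> pm <= t * g t / G t <= pp) ->
    forall k t, 0 <= t -> G (2 ^+ k * t) <= K ^+ k * G t.
Proof.
move=> pp1; set e := (2 * pp)^-1.
have e0 : 0 < e by rewrite invr_gt0 mulr_gt0// (lt_trans _ pp1).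
have short G g pm : young_function G g ->
    (forall t, 0 < t -> pm <= t * g t / G t <= pp) ->
    forall t, 0 <= t -> G ((1 + e) * t) <= 2 * G t.
  by move=> Y ratio; exact: young_short_doubling Y pp1 ratio.
clearbody e; pose m := (Num.truncn e^-1).+1.
(* Bernoulli's inequality *)
have me : 2 <= (1 + e) ^+ m.
  have me1 : 1 <= m%:R * e.
    by rewrite -ler_pdivrMr// div1r ltW// truncnS_gt.
  apply: (@le_trans _ _ (1 + m%:R * e)); first lra.
  elim: m {me1} => [|m IH]; first by rewrite expr0 mul0r addr0.
  rewrite exprS -natr1; have : 0 <= m%:R :> R by []; nra.
exists (2 ^+ m).
  by rewrite exprS ler_peMr// exprn_ege1//; lra.
move=> G g pm Y ratio.
have it k t : 0 <= t -> G ((1 + e) ^+ k * t) <= 2 ^+ k * G t.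
  move=> t0; elim: k => [|k IH]; first by rewrite !expr0 !mul1r.
  rewrite !exprS -!mulrA (le_trans (short _ _ _ Y ratio _ _))//.
    by rewrite mulr_ge0// exprn_ge0//; lra.
  by rewrite ler_pM2l.
move=> k t t0; rewrite -exprM.
apply: le_trans (it (m * k)%N t t0).
apply: (young_le _ _ Y); first by rewrite mulr_ge0// exprn_ge0.
by rewrite ler_wpM2r// exprM lerXn2r// nnegrE ?exprn_ge0//; lra.
Qed.

(** * Measurability and Euclidean norm in R^n *)

Section euclidean_space.
Context {R : realType}.
Implicit Types n : nat.

(** The sigma-algebra is generated by the coordinates, while open sets are
    those of the sup norm: an open set is the countable union of the cubes with
    rational centers and half-sides 1/(k+1) that it contains. *)
Lemma open_measurable_rV n (A : set 'rV[R]_n) : open A -> measurable A.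
Proof.
move=> oA.
pose box (p : 'rV[rat]_n * nat) : set 'rV[R]_n :=
  [set x | forall i, `|x ord0 i - ratr (p.1 ord0 i)| < p.2.+1%:R^-1].
have mbox p : measurable (box p).
  rewrite (_ : box p = \bigcap_(i in [set: 'I_n])
    ((fun x : 'rV[R]_n => x ord0 i) @^-1`
     ball (ratr (p.1 ord0 i) : R) p.2.+1%:R^-1)); last first.
    apply/seteqP; split => x /= xp i => [_|]; rewrite /ball/=.
      by rewrite distrC; exact: xp.
    by rewrite distrC; exact: xp.
  apply: fin_bigcap_measurable => // i _; rewrite -[_ @^-1` _]setTI.
  by apply: (measurable_coord i) => //; exact: measurable_ball.
rewrite (_ : A = \bigcup_(p in [set: 'rV[rat]_n * nat])
    (if `[< box p `<=` A >] then box p else set0)); last first.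
  apply/seteqP; split => x; last by case=> p _; case: asboolP => // + ?; exact.
  move=> Ax; have /nbhs_ballP[e /= e0 eA] : nbhs x A by exact: open_nbhs_nbhs.
  pose k := Num.truncn (2 / e).
  have ke : 2 * k.+1%:R^-1 < e.
    rewrite ltr_pdivrMr// -ltr_pdivrMl// mulrC.
    by rewrite (lt_le_trans (truncnS_gt _)).
  have k0 : 0 < k.+1%:R^-1 :> R by rewrite invr_gt0.
  have /choice[q qx] i : exists q : rat, `|x ord0 i - ratr q| < k.+1%:R^-1.
    move: k0; move: (k.+1%:R^-1 : R) => d d0.
    have [|q] := @rat_in_itvoo R (x ord0 i - d) (x ord0 i + d); first by lra.
    by rewrite in_itv/= => /andP[? ?]; exists q; rewrite ltr_norml; apply/andP; split; lra.
  exists (\row_i q i, k) => //; case: asboolP => [_ i|]; first by rewrite mxE.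
  case=> y /= yq; apply: eA; split=> // i j; rewrite ord1 /ball/=.
  have := yq j; rewrite mxE => yqj.
  rewrite (le_lt_trans (ler_distD (ratr (q j)) _ _))//.
  rewrite (lt_trans _ ke)// mulr_natl mulr2n ltrD//. by rewrite distrC.
apply: countable_bigcupT_measurable => // p.
by case: asboolP.
Qed.

Lemma enorm_ge0 n (x : 'rV[R]_n) : 0 <= enorm x.
Proof. exact: sqrtr_ge0. Qed.

Lemma dotv_ge0 n (x : 'rV[R]_n) : 0 <= dotv x x.
Proof. by apply: sumr_ge0 => i _; rewrite -expr2 sqr_ge0. Qed.

Lemma enorm_gt0 n (x : 'rV[R]_n) : x != 0 -> 0 < enorm x.
Proof.
move=> x0; rewrite sqrtr_gt0 lt_neqAle dotv_ge0 andbT eq_sym.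
apply: contra x0 => /eqP xx0; apply/eqP/rowP => i; rewrite mxE.
apply/eqP; rewrite -sqrf_eq0 expr2; move: xx0 => /eqP.
by rewrite psumr_eq0 => [/allP/(_ i)|j _]; rewrite ?mem_index_enum -?expr2 ?sqr_ge0//; apply.
Qed.

Lemma enorm0 n : enorm (0 : 'rV[R]_n) = 0.
Proof.
rewrite /enorm (_ : dotv _ _ = 0) ?sqrtr0//.
by apply: big1 => i _; rewrite mxE mul0r.
Qed.

Lemma enorm_le n (x : 'rV[R]_n) (r : R) : 0 <= r ->
  (forall i, `|x ord0 i| <= r) -> enorm x <= n%:R * r.
Proof.
move=> r0 xr; case: n x xr => [|n] x xr.
  by rewrite mul0r /enorm /dotv big_ord0 sqrtr0.
rewrite -(ger0_norm (mulr_ge0 (ler0n _ _) r0)) -sqrtr_sqr ler_wsqrtr//.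
apply: (@le_trans _ _ (\sum_(i < n.+1) r ^+ 2)).
  by apply: ler_sum => i _; rewrite -expr2 -real_normK ?num_real// ler_sqr ?nnegrE.
rewrite sumr_const card_ord -[leLHS]mulr_natl exprMn ler_wpM2r ?sqr_ge0//.
by rewrite expr2 ler_peMr// ler1n.
Qed.

Lemma measurable_enorm_dist n :
  measurable_fun setT (fun z : 'rV[R]_n * 'rV[R]_n => enorm (z.1 - z.2)).
Proof.
have -> : (fun z : 'rV[R]_n * 'rV[R]_n => enorm (z.1 - z.2)) =
    Num.sqrt \o (fun z : 'rV[R]_n * 'rV[R]_n => \sum_(i < n) (z.1 ord0 i - z.2 ord0 i) ^+ 2).
  apply/funext => z /=; congr Num.sqrt.
  by apply: eq_bigr => i _; rewrite !mxE expr2.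
apply: measurableT_comp.
  by apply: continuous_measurable_fun; exact: sqrt_continuous.
apply: measurable_sum => i; apply: measurable_funX; apply: measurable_funB.
- exact: (measurableT_comp (measurable_coord i) measurable_fst).
- exact: (measurableT_comp (measurable_coord i) measurable_snd).
Qed.

End euclidean_space.

(** * A Poincare inequality for small supports *)

Section gagliardo.
Context {R : realType}.
Variables (n : nat) (s : R) (G g : R -> R).
Hypothesis Y : young_function G g.
Implicit Types u v w : 'rV[R]_n -> R.

Lemma measurable_hoelder_quot (a : R) w :
  measurable_fun setT (w : 'rV[R]_n -> measurableTypeR R) ->
  measurable_fun setT (fun z : 'rV[R]_n * 'rV[R]_n => hoelder_quot a w z.1 z.2).
Proof.
move=> mw.
have -> : (fun z : 'rV[R]_n * 'rV[R]_n => hoelder_quot a w z.1 z.2) =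
    fun z => (w z.1 - w z.2) * enorm (z.1 - z.2) `^ (- a).
  by apply/funext => z; rewrite powRN.
apply: measurable_funM; first apply: measurable_funB.
- exact: (measurableT_comp mw measurable_fst).
- exact: (measurableT_comp mw measurable_snd).
- apply: (measurableT_comp (measurable_powR _)).
  exact: measurable_enorm_dist.
Qed.

Lemma measurable_gagliardo w :
  measurable_fun setT (w : 'rV[R]_n -> measurableTypeR R) ->
  measurable_fun setT (fun z : 'rV[R]_n * 'rV[R]_n =>
    G `|hoelder_quot s w z.1 z.2| / enorm (z.1 - z.2) ^+ n).
Proof.
move=> mw; under eq_fun => z.
  rewrite -powR_mulrn ?enorm_ge0// -powRN (young_abs _ _ Y).
  over.
apply: measurable_funM.
  apply: (measurableT_comp (measurable_young _ _ Y)).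
  exact: measurable_hoelder_quot.
apply: (measurableT_comp (measurable_powR _)).
exact: measurable_enorm_dist.
Qed.

Lemma gagliardo_ge0 w (z : 'rV[R]_n * 'rV[R]_n) :
  0 <= G `|hoelder_quot s w z.1 z.2| / enorm (z.1 - z.2) ^+ n.
Proof. by rewrite divr_ge0 ?(young_ge0 _ _ Y)// exprn_ge0// enorm_ge0. Qed.

Lemma measurable_box (a b : 'rV[R]_n) :
  measurable [set x : 'rV[R]_n | forall i, a ord0 i < x ord0 i <= b ord0 i].
Proof.
rewrite (_ : [set x : 'rV[R]_n | _] =
  \bigcap_(i in [set: 'I_n])
    ((fun x : 'rV[R]_n => x ord0 i) @^-1` `]a ord0 i, b ord0 i])).
  apply: fin_bigcap_measurable => // i _; rewrite -[_ @^-1` _]setTI.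
  by apply: (measurable_coord i) => //; exact: measurable_itv.
apply/seteqP; split => x /= ab i => [_|]; first by rewrite /= in_itv/= ab.
by have := ab i I; rewrite /= in_itv.
Qed.

Lemma measurable_support w :
  measurable_fun setT (w : 'rV[R]_n -> measurableTypeR R) ->
  measurable [set x | w x != 0].
Proof.
move=> mw; rewrite (_ : [set x | _] = w @^-1` (~` [set 0])).
  by rewrite -[_ @^-1` _]setTI; apply: mw => //; exact: measurableC.
by apply/seteqP; split => x /= /eqP.
Qed.

(** D is what the set A leaves of the cube of half-side r centered at x, whose
    volume [(2 * r) ^+ n] is at least twice [r ^+ n]. *)
Lemma cube_off_small_set (A : set 'rV[R]_n) (x : 'rV[R]_n) (r : R) :
  (0 < n)%N -> 0 < r -> measurable A ->
  (lebesgue_rV n A <= (r ^+ n)%:E)%E ->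
  exists2 D : set 'rV[R]_n, measurable D /\ ((r ^+ n)%:E <= lebesgue_rV n D)%E &
    forall y, D y -> ~ A y /\ forall i, `|x ord0 i - y ord0 i| <= r.
Proof.
move=> n0 r0 mA Ar.
pose a := x - const_mx r; pose b := x + const_mx r.
pose Q := [set y : 'rV[R]_n | forall i, a ord0 i < y ord0 i <= b ord0 i].
have mQ : measurable Q by exact: measurable_box.
have muQ : lebesgue_rV n Q = ((2 * r) ^+ n)%:E.
  rewrite lebesgue_rV_box; last by move=> i; rewrite !mxE; lra.
  congr EFin; rewrite -[in RHS](card_ord n) -prodr_const.
  by apply: eq_bigr => i _; rewrite !mxE; ring.
have Qfin : (lebesgue_rV n Q < +oo)%E by rewrite muQ ltry.
exists (Q `\` A); last first.
  move=> y [Qy nAy]; split => // i; have := Qy i; rewrite !mxE => /andP[? ?].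
  by rewrite ler_norml; apply/andP; split; lra.
split; first exact: measurableD.
rewrite measureD//= muQ leeBrDr ?ge0_fin_numE//; last first.
  apply: (le_lt_trans _ Qfin).
  by apply: le_measure; rewrite ?inE//; exact: measurableI.
rewrite (@le_trans _ _ ((r ^+ n)%:E + (r ^+ n)%:E)%E)//.
  rewrite leeD2l// (le_trans _ Ar)//.
  by apply: le_measure; rewrite ?inE//; exact: measurableI.
rewrite -EFinD lee_fin exprMn -mulr2n -[leLHS]mulr_natl ler_wpM2r ?exprn_ge0 ?(ltW r0)//.
by case: (n) n0 => // m _; rewrite exprS ler_peMr// exprn_ege1//; lra.
Qed.

(** Each point x of the support sees, at distance at most [n * r], a set of
    measure at least [r ^+ n] where w vanishes.  There the difference quotient
    of w is at least [`|w x| / (n * r) `^ s], convexity of G extracts the factor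
    [(n * r) `^ - s], and the kernel is at least [(n * r) ^- n]. *)
Lemma small_support_poincare w (r : R) : (0 < n)%N -> 0 <= s ->
  0 < r -> n%:R * r <= 1 ->
  measurable_fun setT (w : 'rV[R]_n -> measurableTypeR R) ->
  (lebesgue_rV n [set x | w x != 0%R] <= (r ^+ n)%:E)%E ->
  (\int[lebesgue_rV n]_x (G `|w x|)%:E <=
    (n%:R ^+ n * (n%:R * r) `^ s)%:E * Phis s G w)%E.
Proof.
move=> n0 s0 r0 nr1 mw Ar; set rho := n%:R * r.
have rho0 : 0 < rho by rewrite mulr_gt0// ltr0n.
have rhos0 : 0 < rho `^ s by rewrite powR_gt0.
have rhos1 : rho `^ s <= 1.
  by rewrite -[leRHS](powRr0 rho) ger_powR// rho0.
set C := n%:R ^+ n * rho `^ s.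
have C0 : 0 < C by rewrite mulr_gt0// exprn_gt0// ltr0n.
have k0 : 0 <= (rho `^ s)^-1 / rho ^+ n.
  by rewrite divr_ge0 ?invr_ge0 ?exprn_ge0 ?powR_ge0 ?(ltW rho0).
have CE : (rho `^ s)^-1 / rho ^+ n * r ^+ n = C^-1.
  rewrite /C /rho exprMn; field; rewrite !gt_eqF// ?exprn_gt0 ?ltr0n//.
pose f := fun z : 'rV[R]_n * 'rV[R]_n =>
  (G `|hoelder_quot s w z.1 z.2| / enorm (z.1 - z.2) ^+ n)%:E.
have mf : measurable_fun setT f.
  by apply/measurable_EFinP; exact: measurable_gagliardo.
have f0 z : (0 <= f z)%E by rewrite lee_fin; exact: gagliardo_ge0.
have -> : Phis s G w =
    (\int[lebesgue_rV n]_x \int[lebesgue_rV n]_y f (x, y))%E.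
  by rewrite /Phis -/f fubini_tonelli1.
have mF := measurable_fun_fubini_tonelli_F (m2 := lebesgue_rV n) f mf f0.
have mGw : measurable_fun setT (fun x => (G `|w x|)%:E).
  apply/measurable_EFinP; apply: (measurableT_comp (measurable_young _ _ Y)).
  exact: measurableT_comp.
(* It suffices to bound the inner integral for each x, by Tonelli. *)
have C1 x : ((G `|w x|)%:E <= C%:E * \int[lebesgue_rV n]_y f (x, y))%E.
  have [wx0|wx] := eqVneq (w x) 0.
    rewrite wx0 normr0 (young0 _ _ Y) mule_ge0 ?lee_fin ?(ltW C0)//.
    exact: integral_ge0.
  have [D [mD rD] Dy] := cube_off_small_set _ x _ n0 r0 (measurable_support _ mw) Ar.
  rewrite -lee_pdivrMl//.
  apply: (@le_trans _ _ (\int[lebesgue_rV n]_(y in D)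
      ((rho `^ s)^-1 / rho ^+ n * G `|w x|)%:E)%E).
    rewrite integral_cst//.
    apply: le_trans (lee_wpmul2l _ rD); last first.
      by rewrite lee_fin mulr_ge0 ?(young_ge0 _ _ Y).
    by rewrite -!EFinM lee_fin mulrAC CE.
  have mfx : measurable_fun setT (fun y => f (x, y)) by exact: measurableT_comp.
  apply: (@le_trans _ _ (\int[lebesgue_rV n]_(y in D) f (x, y))%E); last first.
    by apply: ge0_subset_integral => //; exact: measurableT.
  apply: ge0_le_integral => //.
  - by move=> y _; rewrite lee_fin mulr_ge0 ?(young_ge0 _ _ Y).
  - exact: measurable_funTS.
  move=> y /Dy[/= /negP]; rewrite negbK => /eqP wy xy.
  have xy0 : 0 < enorm (x - y).
    apply: enorm_gt0; rewrite subr_eq0; apply: contra_neq wx => ->; exact: wy.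
  have xyrho : enorm (x - y) <= rho.
    by apply: enorm_le => [|i]; [exact: ltW|rewrite !mxE].
  rewrite lee_fin mulrAC; apply: ler_pM.
  - by rewrite mulr_ge0 ?(young_ge0 _ _ Y)// invr_ge0 ltW.
  - by rewrite invr_ge0 exprn_ge0 ?(ltW rho0).
  - rewrite /hoelder_quot wy subr0 normrM normfV (ger0_norm (powR_ge0 _ _)).
    apply: (@le_trans _ _ (G ((rho `^ s)^-1 * `|w x|))).
      by apply: (young_scale _ _ Y) => //; rewrite invf_ge1.
    apply: (young_le _ _ Y); first by rewrite mulr_ge0 ?invr_ge0 ?(ltW rhos0).
    rewrite mulrC ler_wpM2l// lef_pV2 ?posrE ?powR_gt0//.
    by rewrite ge0_ler_powR ?nnegrE ?(ltW xy0) ?(ltW rho0).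
  - rewrite lef_pV2 ?posrE ?exprn_gt0//.
    by rewrite lerXn2r ?nnegrE ?(ltW xy0) ?(ltW rho0).
rewrite -ge0_integralZl//; last 2 first.
- by move=> x _; exact: integral_ge0.
- by rewrite lee_fin ltW.
apply: ge0_le_integral => //.
- by move=> x _; rewrite lee_fin (young_ge0 _ _ Y).
- exact: measurable_funeM.
Qed.

End gagliardo.

(** * Energy estimate for the excess over a level *)

Section energy.
Context {R : realType}.
Variables (n : nat) (s : R) (G g : R -> R) (Omega : set 'rV[R]_n).
Hypothesis Y : young_function G g.
Hypothesis mOmega : measurable Omega.
Implicit Types u v w : 'rV[R]_n -> R.

Definition excess (c : R) u : 'rV[R]_n -> R := fun x => Num.max (u x - c) 0.

Lemma excess_ge0 c u x : 0 <= excess c u x.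
Proof. by rewrite le_max lexx orbT. Qed.

Lemma excess_le c u x : 0 <= c -> excess c u x <= `|u x|.
Proof. by move=> c0; rewrite ge_max normr_ge0 andbT; have := ler_norm (u x); lra. Qed.

Lemma measurable_excess c u :
  measurable_fun setT (u : 'rV[R]_n -> measurableTypeR R) ->
  measurable_fun setT (excess c u : 'rV[R]_n -> measurableTypeR R).
Proof.
move=> mu; apply: measurable_maxr => //.
by apply: measurable_funB => //.
Qed.

Lemma hoelder_quotE a u x y :
  hoelder_quot a u x y = (u x - u y) * (enorm (x - y) `^ a)^-1.
Proof. by []. Qed.

Lemma excess_mono c u x y : u x <= u y -> excess c u x <= excess c u y.
Proof. by move=> xy; rewrite ge_max !le_max lexx orbT lerB. Qed.

Lemma excess_lipschitz c u x y :
  `|excess c u x - excess c u y| <= `|u x - u y|.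
Proof.
wlog xy : x y / u y <= u x.
  move=> H; have [xy|/ltW xy] := leP (u y) (u x); first exact: H.
  by rewrite distrC (distrC (u x)); exact: H.
rewrite ger0_norm ?subr_ge0 ?excess_mono// ger0_norm ?subr_ge0//.
by rewrite /excess; case: (leP (u x - c) 0); case: (leP (u y - c) 0); lra.
Qed.

Lemma hoelder_quot_le u w x y : `|w x - w y| <= `|u x - u y| ->
  `|hoelder_quot s w x y| <= `|hoelder_quot s u x y|.
Proof.
by move=> wu; rewrite !normrM ler_wpM2r.
Qed.

Lemma measurable_young_abs D u : measurable D ->
  measurable_fun setT (u : 'rV[R]_n -> measurableTypeR R) ->
  measurable_fun D (fun x => (G `|u x|)%:E).
Proof.
move=> mD mu; apply: measurable_funTS; apply/measurable_EFinP.
apply: (measurableT_comp (measurable_young _ _ Y)).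
exact: measurableT_comp.
Qed.

(** Truncation is 1-Lipschitz and decreases absolute values, so it preserves
    finiteness of both modulars. *)
Lemma WsG0_excess c u : 0 <= c -> WsG0 s G Omega u ->
  WsG0 s G Omega (excess c u).
Proof.
move=> c0 [[mu uoo] u0]; have mw := measurable_excess c _ mu.
split; last first.
  by apply: filterS u0 => x ux /ux; rewrite /excess => ->; rewrite max_r// lerBlDl addr0.
split=> //; apply: le_lt_trans uoo; apply: leeD.
  apply: ge0_le_integral => //.
  - by move=> z _; rewrite lee_fin (gagliardo_ge0 _ _ _ _ Y).
  - by apply/measurable_EFinP; exact: measurable_gagliardo Y _ mw.
  - by apply/measurable_EFinP; exact: measurable_gagliardo Y _ mu.
  - move=> z _; rewrite lee_fin ler_wpM2r ?invr_ge0 ?exprn_ge0 ?enorm_ge0//.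
    apply: (young_le _ _ Y) => //.
    by apply: hoelder_quot_le; exact: excess_lipschitz.
apply: ge0_le_integral => //.
- by move=> x _; rewrite lee_fin (young_ge0 _ _ Y).
- exact: measurable_young_abs.
- exact: measurable_young_abs.
- move=> x _; rewrite lee_fin (young_le _ _ Y)// ger0_norm ?excess_ge0//.
  exact: excess_le.
Qed.

(** Difference quotients of the excess have the sign of those of u and are
    smaller, so monotonicity of g compares the two nonlinear fluxes. *)
Lemma flux_excess_ge c u x y : (0 < n)%N ->
  G `|hoelder_quot s (excess c u) x y| / enorm (x - y) ^+ n <=
  g (hoelder_quot s u x y) *
    ((excess c u x - excess c u y) / enorm (x - y) `^ (n%:R + s)).
Proof.
move=> n0; have [->|xy] := eqVneq x y.
  by rewrite !subrr enorm0 expr0n (gtn_eqF n0) invr0 mulr0 mul0r mulr0.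
have e0 : 0 < enorm (x - y) by rewrite enorm_gt0// subr_eq0.
set A := hoelder_quot s _ x y; set B := hoelder_quot s u x y.
have -> : g B * ((excess c u x - excess c u y) / enorm (x - y) `^ (n%:R + s)) =
    g B * A / enorm (x - y) ^+ n.
  rewrite powRD; last by apply/implyP => _; rewrite gt_eqF.
  rewrite powR_mulrn ?enorm_ge0// invfM /A hoelder_quotE.
  by rewrite -!mulrA; congr (_ * (_ * _)); rewrite mulrC.
rewrite ler_wpM2r ?invr_ge0 ?exprn_ge0 ?enorm_ge0//.
have AB : `|A| <= `|B| by apply: hoelder_quot_le; exact: excess_lipschitz.
have flux a b : 0 <= a -> a <= b -> G a <= g b * a.
  move=> a0 ab; apply: le_trans (young_le_deriv _ _ Y _ a0) _.
  by rewrite mulrC ler_wpM2r// (young_deriv_mono _ _ Y).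
have ei0 : 0 <= (enorm (x - y) `^ s)^-1 by rewrite invr_ge0 powR_ge0.
have [uxy|/ltW uxy] := leP (u x) (u y).
  have A0 : A <= 0 by rewrite mulr_le0_ge0// subr_le0 excess_mono.
  have B0 : B <= 0 by rewrite mulr_le0_ge0// subr_le0.
  rewrite -[g B * A]mulrNN -(young_odd Y); move: AB.
  by rewrite !ler0_norm//; apply: flux; rewrite oppr_ge0.
have A0 : 0 <= A by rewrite mulr_ge0// subr_ge0 excess_mono.
have B0 : 0 <= B by rewrite mulr_ge0// subr_ge0.
by move: AB; rewrite !ger0_norm//; exact: flux.
Qed.

Lemma reaction_ge0 c u x : 0 <= c -> 0 <= g (u x) * excess c u x.
Proof.
move=> c0; have [uc|uc] := leP (u x) c.
  by rewrite /excess max_r ?mulr0// subr_le0.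
by rewrite mulr_ge0 ?excess_ge0 ?(young_deriv_ge0 _ _ Y)//; lra.
Qed.

(** The weak formulation tested with the excess itself. *)
Lemma energy_excess lambda c u : (0 < n)%N -> 0 <= c ->
  weak_solution s G g Omega lambda u ->
  (Phis s G (excess c u) <=
   `|lambda|%:E * \int[lebesgue_rV n]_(x in Omega) (g (u x) * excess c u x)%:E)%E.
Proof.
move=> n0 c0 [uW weak]; have wW := WsG0_excess c u c0 uW.
have [[mu _] _] := uW; have [[mw _] _] := wW.
have gw0 x := reaction_ge0 c u x c0.
apply: (@le_trans _ _ (lambda%:E *
    \int[lebesgue_rV n]_(x in Omega) (g (u x) * excess c u x)%:E)%E); last first.
  apply: lee_wpmul2r; last by rewrite lee_fin ler_norm.
  by apply: integral_ge0 => x _; rewrite lee_fin.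
rewrite -(weak _ wW); apply: ge0_le_integral => //.
- by move=> z _; rewrite lee_fin (gagliardo_ge0 _ _ _ _ Y).
- by apply/measurable_EFinP; exact: measurable_gagliardo Y _ mw.
- apply/measurable_EFinP; apply: measurable_funM.
    apply: (measurableT_comp (measurable_young_deriv _ _ Y)).
    exact: measurable_hoelder_quot.
  exact: (measurable_hoelder_quot _ (n%:R + s) _ mw).
- by move=> z _; rewrite lee_fin; exact: flux_excess_ge.
Qed.

End energy.

Arguments excess {R n} c u x.

(** * De Giorgi iteration *)

Section iteration.
Context {R : realType}.
Variables (n : nat) (s lambda : R) (G g : R -> R) (pm pp K : R).
Variables (Omega : set 'rV[R]_n) (u : 'rV[R]_n -> R).
Hypothesis n_gt0 : (0 < n)%N.
Hypothesis s_ge0 : 0 <= s.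
Hypothesis pp_gt1 : 1 < pp.
Hypothesis K_ge2 : 2 <= K.
Hypothesis Y : young_function G g.
Hypothesis ratio : forall t : R, 0 < t -> pm <= t * g t / G t <= pp.
Hypothesis doubling : forall k t, 0 <= t -> G (2 ^+ k * t) <= K ^+ k * G t.
Hypothesis mOmega : measurable Omega.
Hypothesis weak : weak_solution s G g Omega lambda u.

Let muu : measurable_fun setT (u : 'rV[R]_n -> measurableTypeR R).
Proof. by have [[[]]] := weak. Qed.

Lemma excess_gt0 c c' x : c <= c' -> excess c' u x != 0 ->
  c' < u x /\ excess c u x = u x - c.
Proof.
move=> cc' wx; have c'u : c' < u x.
  by rewrite ltNge; apply: contra wx => uc'; rewrite /excess max_r// subr_le0.
by split=> //; rewrite /excess max_l// subr_ge0; lra.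
Qed.

(** Chebyshev's inequality for the superlevel sets. *)
Lemma excess_support_le c c' : 0 <= c -> c < c' ->
  ((G (c' - c))%:E * lebesgue_rV n [set x | excess c' u x != 0%R] <=
   Phi G Omega (excess c u))%E.
Proof.
move=> c0 cc'; set S := [set x | _].
have mS : measurable S by apply: measurable_support; exact: measurable_excess.
have uN : lebesgue_rV n (S `\` Omega) = 0%E.
  apply/negligibleP; first exact: measurableD.
  case: weak => -[_ [N [mN N0 NP]]] _; exists N; split => //.
  apply: subset_trans NP => x [/= Sx nO] /(_ nO) ux0.
  have [] := excess_gt0 c c' x (ltW cc') Sx.
  by rewrite ux0; lra.
have -> : lebesgue_rV n S = lebesgue_rV n (S `&` Omega).
  by rewrite (measureDI (lebesgue_rV n) mS mOmega) [X in (X + _)%E]uN add0e.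
have mSO : measurable (S `&` Omega) by exact: measurableI.
rewrite -integral_cst//.
apply: (@le_trans _ _ (\int[lebesgue_rV n]_(x in S `&` Omega) (G `|excess c u x|)%:E)%E).
  apply: ge0_le_integral => //.
  - by move=> x _; rewrite lee_fin (young_ge0 _ _ Y).
  - by apply: (measurable_young_abs _ _ _ Y) => //; exact: measurable_excess.
  - move=> x [Sx _] /=; have [c'u ->] := excess_gt0 c c' x (ltW cc') Sx.
    by rewrite lee_fin ger0_norm ?(young_le _ _ Y)//; lra.
apply: ge0_subset_integral => //.
- by apply: (measurable_young_abs _ _ _ Y) => //; exact: measurable_excess.
- by move=> x _; rewrite lee_fin (young_ge0 _ _ Y).
Qed.

(** On the superlevel set of c', u itself is controlled by its excess over the
    lower level c, at the price of j doublings. *)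
Lemma reaction_le c c' j x : 0 <= c -> c < c' -> c' <= 2 ^+ j * (c' - c) ->
  g (u x) * excess c' u x <= pp * K ^+ j * G `|excess c u x|.
Proof.
move=> c0 cc' c'j; have pp1 := pp_gt1; have K2 := K_ge2.
have [->|wx] := eqVneq (excess c' u x) 0.
  rewrite mulr0 mulr_ge0 ?(young_ge0 _ _ Y)// mulr_ge0 ?exprn_ge0//; lra.
have [c'u wE] := excess_gt0 c c' x (ltW cc') wx.
have ux0 : 0 <= u x by lra.
apply: (@le_trans _ _ (u x * g (u x))).
  rewrite mulrC ler_wpM2r ?(young_deriv_ge0 _ _ Y)//.
  by rewrite -[leRHS]ger0_norm// excess_le//; lra.
apply: le_trans (young_deriv_le _ _ _ _ Y ratio _ ux0) _.
rewrite -mulrA ler_wpM2l//; first lra.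
rewrite (young_abs _ _ Y); apply: (le_trans _ (doubling j _ (excess_ge0 _ c u x))).
apply: (young_le _ _ Y) => //; rewrite wE.
have j1 : 1 <= 2 ^+ j :> R by rewrite exprn_ege1//; lra.
nra.
Qed.

(** The hypothesis on the modular makes the superlevel set of c' fit, by
    Chebyshev, in the measure [r ^+ n] allowed by the Poincare inequality, whose
    factor [(n * r) `^ s] is the gain. *)
Lemma degiorgi_step c c' j r : 0 <= c -> c < c' ->
  c' <= 2 ^+ j * (c' - c) -> 0 < r -> n%:R * r <= 1 ->
  (Phi G Omega (excess c u) <= (G (c' - c) * r ^+ n)%:E)%E ->
  (Phi G Omega (excess c' u) <=
    (n%:R ^+ n * (n%:R * r) `^ s * `|lambda| * (pp * K ^+ j))%:E *
      Phi G Omega (excess c u))%E.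
Proof.
move=> c0 cc' c'j r0 nr1 Ur; have pp1 := pp_gt1; have K2 := K_ge2.
have d0 : 0 < G (c' - c) by rewrite (young_pos _ _ Y)// subr_gt0.
have Ar : (lebesgue_rV n [set x | excess c' u x != 0%R] <= (r ^+ n)%:E)%E.
  rewrite -(@lee_pmul2l _ (G (c' - c))%:E)//.
  by rewrite -EFinM; apply: le_trans Ur; exact: excess_support_le.
have mw c1 := measurable_excess _ c1 _ muu.
have mG c1 D (mD : measurable D) := measurable_young_abs _ _ _ Y _ _ mD (mw c1).
have c'0 : 0 <= c' by lra.
have P0 : 0 <= pp * K ^+ j by rewrite mulr_ge0 ?exprn_ge0//; lra.
apply: (@le_trans _ _ (\int[lebesgue_rV n]_x (G `|excess c' u x|)%:E)%E).
  apply: ge0_subset_integral => //; first exact: mG.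
  by move=> x _; rewrite lee_fin (young_ge0 _ _ Y).
apply: le_trans (small_support_poincare _ _ _ _ Y _ _ n_gt0 s_ge0 r0 nr1 (mw _) Ar) _.
rewrite -[(_ * _ * `|lambda| * _)%R]mulrA [in leRHS]EFinM -[leRHS]muleA.
apply: lee_wpmul2l.
  by rewrite lee_fin mulr_ge0 ?exprn_ge0 ?powR_ge0.
apply: le_trans (energy_excess _ _ _ _ _ Y mOmega _ _ _ n_gt0 c'0 weak) _.
rewrite EFinM -muleA; apply: lee_wpmul2l; first by rewrite lee_fin.
rewrite -ge0_integralZl//; last 2 first.
- exact: mG.
- by move=> x _; rewrite lee_fin (young_ge0 _ _ Y).
apply: ge0_le_integral => //.
- move=> x _; rewrite lee_fin; exact: reaction_ge0 Y _ _ _ c'0.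
- apply: measurable_funTS; apply/measurable_EFinP; apply: measurable_funM; last exact: mw.
  exact: (measurableT_comp (measurable_young_deriv _ _ Y)).
- by apply: measurable_funeM; exact: mG.
- by move=> x _; rewrite -EFinM lee_fin; exact: reaction_le.
Qed.

Lemma Phi_excess_anti c c' : 0 <= c -> c <= c' ->
  (Phi G Omega (excess c' u) <= Phi G Omega (excess c u))%E.
Proof.
move=> c0 cc'; apply: ge0_le_integral => //.
- by move=> x _; rewrite lee_fin (young_ge0 _ _ Y).
- by apply: (measurable_young_abs _ _ _ Y) => //; exact: measurable_excess.
- by apply: (measurable_young_abs _ _ _ Y) => //; exact: measurable_excess.
move=> x _; rewrite lee_fin (young_le _ _ Y)// !ger0_norm ?excess_ge0//.
by rewrite ge_max !le_max lexx orbT andbT lerB.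
Qed.

(** The radius at step k is [rho * q ^+ k / n] and the levels increase to M.
    The condition on q says that each shrinking of the radius compensates one
    doubling; [contraction] is then the factor of a step, and the lower bound on
    M starts the iteration. *)
Section decay.
Variables (rho q M m : R).
Hypothesis rho_gt0 : 0 < rho.
Hypothesis rho_le1 : rho <= 1.
Hypothesis q_gt0 : 0 < q.
Hypothesis q_le1 : q <= 1.
Hypothesis qs : q `^ s = K^-1.
Hypothesis contraction :
  n%:R ^+ n * rho `^ s * `|lambda| * pp * K <= q ^+ n / K.
Hypothesis M_ge1 : 1 <= M.
Hypothesis m_ge0 : 0 <= m.
Hypothesis mM : m * K <= M * (rho / n%:R) ^+ n.
Hypothesis mass : (Phi G Omega (excess 0 u) <= m%:E)%E.

Let K_gt0 : 0 < K. Proof. by rewrite (lt_le_trans _ K_ge2). Qed.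
Let M_gt0 : 0 < M. Proof. by rewrite (lt_le_trans _ M_ge1). Qed.

Let level k := M * (1 - 2 ^- k).

Let level_ge0 k : 0 <= level k.
Proof.
by rewrite mulr_ge0 ?(ltW M_gt0)// subr_ge0 invf_le1 ?exprn_gt0// exprn_ege1// ler1n.
Qed.

Let levelS k : level k.+1 - level k = M / 2 ^+ k.+1.
Proof. by rewrite /level exprS; field; rewrite expf_neq0. Qed.

(** In the induction step the factor [K ^+ k.+1] of the reaction term meets
    [(q ^+ k) `^ s = K ^- k] from the Poincare constant, which leaves the factor
    bounded in [contraction].  The rate [q ^+ n / K] is the largest for which the
    k-th superlevel set keeps fitting in the shrinking radius. *)
Lemma Phi_excess_decay k :
  (Phi G Omega (excess (level k) u) <= (m * (q ^+ n / K) ^+ k)%:E)%E.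
Proof.
have n0 : 0 < n%:R :> R by rewrite ltr0n.
elim: k => [|k IH].
  by rewrite /level expr0 invr1 subrr mulr0 expr0 mulr1.
set th := q ^+ n / K.
have th0 : 0 < th by rewrite divr_gt0 ?exprn_gt0.
have qk0 : 0 < q ^+ k by rewrite exprn_gt0.
have qk1 : q ^+ k <= 1 by rewrite exprn_ile1// ltW.
pose r := rho * q ^+ k / n%:R.
have rn : n%:R * r = rho * q ^+ k by rewrite /r; field; rewrite gt_eqF.
have d0 : 0 < M / 2 ^+ k.+1 by rewrite divr_gt0// exprn_gt0.
have Ul : (Phi G Omega (excess (level k) u) <=
    (G (level k.+1 - level k) * r ^+ n)%:E)%E.
  apply: le_trans IH _; rewrite lee_fin levelS.
  (* the normalization G 1 = 1 enters here, through convexity *)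
  have GM : M <= K ^+ k.+1 * G (M / 2 ^+ k.+1).
    apply: le_trans (doubling k.+1 _ (ltW d0)).
    rewrite mulrC divfK ?expf_neq0// -[leLHS]mulr1 -(young_normalized Y).
    by rewrite -[X in _ <= G X]mulr1 (young_scale _ _ Y).
  rewrite -(@ler_pM2l _ (K ^+ k.+1)) ?exprn_gt0// mulrA.
  apply: (@le_trans _ _ (M * r ^+ n)); last first.
    by rewrite mulrA ler_wpM2r// exprn_ge0// divr_ge0 ?mulr_ge0 ?(ltW qk0) ?(ltW rho_gt0).
  rewrite (_ : r ^+ n = (rho / n%:R) ^+ n * (q ^+ k) ^+ n); last first.
    by rewrite -exprMn /r; congr (_ ^+ _); ring.
  rewrite (_ : _ * _ ^+ k = m * K * (q ^+ k) ^+ n); last first.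
    rewrite expr_div_n exprS -!exprM (mulnC k n); field.
    by rewrite expf_neq0// gt_eqF.
  by rewrite mulrA ler_wpM2r// exprn_ge0// ltW.
have lS : level k < level k.+1 by rewrite -subr_gt0 levelS.
have l2 : level k.+1 <= 2 ^+ k.+1 * (level k.+1 - level k).
  rewrite levelS mulrC divfK ?expf_neq0// /level -[leRHS]mulr1 ler_wpM2l ?(ltW M_gt0)//.
have r0 : 0 < r by rewrite divr_gt0// mulr_gt0.
have nr1 : n%:R * r <= 1 by rewrite rn mulr_ile1// ltW.
apply: le_trans (degiorgi_step _ _ _ _ (level_ge0 k) lS l2 r0 nr1 Ul) _.
(* the exponents cancel: (q ^+ k) `^ s * K ^+ k.+1 = K *)
rewrite rn powRM ?(ltW rho_gt0) ?(ltW qk0)//.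
have -> : (q ^+ k) `^ s = K ^- k.
  rewrite -powR_mulrn ?(ltW q_gt0)// -powRrM mulrC powRrM qs.
  by rewrite powR_mulrn ?invr_ge0 ?(ltW K_gt0)// exprVn.
have -> : n%:R ^+ n * (rho `^ s * K ^- k) * `|lambda| * (pp * K ^+ k.+1) =
    n%:R ^+ n * rho `^ s * `|lambda| * pp * K.
  by rewrite exprS; field; rewrite expf_neq0// gt_eqF.
apply: (@le_trans _ _ (th%:E * Phi G Omega (excess (level k) u))%E).
  apply: lee_wpmul2r; last by rewrite lee_fin.
  by apply: integral_ge0 => x _; rewrite lee_fin (young_ge0 _ _ Y).
apply: le_trans (lee_wpmul2l _ IH) _; first by rewrite lee_fin ltW.
by rewrite -EFinM lee_fin exprS mulrCA.
Qed.

Lemma Phi_excess_eq0 : Phi G Omega (excess M u) = 0%E.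
Proof.
apply/eqP; rewrite eq_le; apply/andP; split; last first.
  by apply: integral_ge0 => x _; rewrite lee_fin (young_ge0 _ _ Y).
apply/lee_addgt0Pr => e e0; rewrite add0e.
pose k := Num.truncn (m / e).
have levM : level k <= M.
  by rewrite /level -[leRHS]mulr1 ler_wpM2l ?(ltW M_gt0)// gerBl invr_ge0 exprn_ge0.
apply: le_trans (Phi_excess_anti _ _ (level_ge0 k) levM) _.
apply: le_trans (Phi_excess_decay k) _; rewrite lee_fin.
have th0 : 0 <= q ^+ n / K by rewrite divr_ge0 ?exprn_ge0 ?ltW.
apply: (@le_trans _ _ (m / 2 ^+ k)).
  rewrite ler_wpM2l// -exprVn lerXn2r ?nnegrE//.
  rewrite ler_pdivrMr// (@le_trans _ _ 1) ?exprn_ile1 ?(ltW q_gt0)//.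
  by rewrite mulrC ler_pdivlMr// mul1r.
rewrite ler_pdivrMr ?exprn_gt0// mulrC -ler_pdivrMr//.
apply: (le_trans (ltW (truncnS_gt _))).
by rewrite -natrX ler_nat; exact: ltn_expl.
Qed.

Lemma le_level_ae : \forall x \ae lebesgue_rV n, Omega x -> u x <= M.
Proof.
have mG : measurable_fun Omega (fun x => (G `|excess M u x|)%:E).
  by apply: (measurable_young_abs _ _ _ Y) => //; exact: measurable_excess.
have /(ae_eq_integral_abs _ mOmega mG) :
    (\int[lebesgue_rV n]_(x in Omega) `|(G `|excess M u x|)%:E| = 0)%E.
  rewrite -Phi_excess_eq0; apply: eq_integral => x _.
  by rewrite gee0_abs// lee_fin (young_ge0 _ _ Y).
apply: filterS => x H /H [] /eqP Gx; rewrite leNgt; apply/negP => Mx.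
move: Gx; apply/negP; rewrite gt_eqF// (young_pos _ _ Y)// normr_gt0.
by rewrite /excess max_l ?subr_ge0 ?(ltW Mx)// subr_eq0 gt_eqF.
Qed.

End decay.

End iteration.

(** * Boundedness *)

Section opposite.
Context {R : realType}.
Variables (n : nat) (s : R) (G g : R -> R) (Omega : set 'rV[R]_n).
Hypothesis Y : young_function G g.
Implicit Types u v : 'rV[R]_n -> R.

Lemma hoelder_quotN a u x y :
  hoelder_quot a (\- u) x y = - hoelder_quot a u x y.
Proof. by rewrite /hoelder_quot -opprD mulNr. Qed.

Lemma PhiN u : Phi G Omega (\- u) = Phi G Omega u.
Proof. by apply: eq_integral => x _; rewrite normrN. Qed.

Lemma WsG0N u : WsG0 s G Omega u -> WsG0 s G Omega (\- u).
Proof.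
move=> [[mu uoo] u0]; split; last first.
  by apply: filterS u0 => x ux /ux /= ->; rewrite oppr0.
split; first exact: measurable_funN.
rewrite PhiN (_ : Phis s G (\- u) = Phis s G u)//.
by apply: eq_integral => z _; rewrite hoelder_quotN normrN.
Qed.

(** The problem is odd: bounds from above also give bounds from below. *)
Lemma weak_solutionN lambda u : weak_solution s G g Omega lambda u ->
  weak_solution s G g Omega lambda (\- u).
Proof.
move=> [uW weak]; split; first exact: WsG0N.
move=> v /WsG0N /weak; under eq_integral => z _.
  rewrite -opprD mulNr mulrN -mulNr -(young_odd Y) -hoelder_quotN.
  over.
move=> ->; congr (_ * _)%E; apply: eq_integral => x _.
by rewrite mulrN -mulNr -(young_odd Y).
Qed.

End opposite.

Theorem theorem1 (R : realType) (n : nat) (lambda mu s pm pp : R)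
  (hmu : 0 < mu) (hs : 0 < s < 1) (hpm : 1 < pm) (hpp : pm < pp)
  (hspp : s * pp < n%:R) (hcrit : pp <= n%:R * pm / (n%:R - s * pm)) :
  exists C0 : R, 0 < C0 /\
    forall (Omega : set 'rV[R]_n), open Omega -> bounded_set Omega ->
      lipschitz_boundary Omega ->
    forall (G g : R -> R), young_function G g ->
      (forall t : R, 0 < t -> pm <= t * g t / G t <= pp) ->
    forall u : 'rV[R]_n -> R, weak_solution s G g Omega lambda u ->
      Phi G Omega u = mu%:E ->
      (Lnorm (lebesgue_rV n) +oo (EFin \o (u \_ Omega)) <= C0%:E)%E.
Proof.
have /andP[s0 _] := hs.
have pp1 : 1 < pp by exact: lt_trans hpp.
have n0 : (0 < n)%N.
  rewrite -(ltr0n R); apply: lt_trans hspp.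
  by rewrite mulr_gt0// (lt_trans _ pp1).
have [K K2 doubling] := young_doubling pp pp1.
have K0 : 0 < K by rewrite (lt_le_trans _ K2).
pose q := K^-1 `^ s^-1.
have q0 : 0 < q by rewrite powR_gt0// invr_gt0.
have powsK a : 0 <= a -> (a `^ s^-1) `^ s = a.
  by move=> a0; rewrite -powRrM mulVf ?gt_eqF// powRr1.
have qs : q `^ s = K^-1 by rewrite powsK// invr_ge0 ltW.
have le1 a : 0 < a -> a <= 1 -> a `^ s^-1 <= 1.
  move=> a0 a1; have -> : 1 = 1 `^ s^-1 :> R by rewrite powR1.
  rewrite ge0_ler_powR ?nnegrE ?(ltW a0)//.
  by rewrite invr_ge0 ltW.
have q1 : q <= 1.
  by apply: le1; rewrite ?invr_gt0// invf_le1// (le_trans _ K2)// ler1n.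
pose C := n%:R ^+ n * `|lambda| * pp * K.
have C0 : 0 <= C.
  by rewrite !mulr_ge0 ?exprn_ge0// ltW// (lt_trans _ pp1).
pose th := q ^+ n / K.
have th0 : 0 < th by rewrite divr_gt0 ?exprn_gt0.
have th1 : th <= 1.
  rewrite ler_pdivrMr// mul1r (@le_trans _ _ 1) ?exprn_ile1 ?(ltW q0)//.
  by rewrite (le_trans _ K2)// ler1n.
(* rho `^ s = delta, small enough that C * delta <= th, and at most 1 *)
pose delta := th / (C + 1).
have C1 : 0 < C + 1 by rewrite ltr_wpDl.
have delta0 : 0 < delta by rewrite divr_gt0.
have delta1 : delta <= 1.
  by rewrite ler_pdivrMr// mul1r (le_trans th1)// lerDr.
pose rho := delta `^ s^-1.
have rho0 : 0 < rho by rewrite powR_gt0.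
have rho1 : rho <= 1 by exact: le1.
have contr : n%:R ^+ n * rho `^ s * `|lambda| * pp * K <= q ^+ n / K.
  rewrite powsK ?(ltW delta0)// -/th.
  rewrite (_ : _ * _ * _ * _ * _ = C / (C + 1) * th); last first.
    by rewrite /C /delta; ring.
  by rewrite ler_piMl ?(ltW th0)// ler_pdivrMr// mul1r lerDl.
pose r := rho / n%:R.
have rn0 : 0 < r ^+ n by rewrite exprn_gt0// divr_gt0// ltr0n.
(* M beats both the normalization level 1 and the initial mass mu *)
pose M := Num.max 1 (mu * K / r ^+ n).
have M1 : 1 <= M by rewrite le_max lexx.
have MK : mu * K <= M * r ^+ n.
  by rewrite -ler_pdivrMr// le_max lexx orbT.
exists M; split; first by rewrite (lt_le_trans _ M1).
move=> Omega oO _ _ G g Y ratio u weak uM.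
have mO : measurable Omega by exact: open_measurable_rV.
have half v : weak_solution s G g Omega lambda v -> Phi G Omega v = mu%:E ->
    \forall x \ae lebesgue_rV n, Omega x -> v x <= M.
  move=> vweak vM; have [[[mv _] _] _] := vweak.
  apply: (le_level_ae _ _ _ _ _ pm pp K _ _ n0 (ltW s0) pp1 K2 Y ratio
    (doubling G g pm Y ratio) mO vweak rho q M mu
    rho0 rho1 q0 q1 qs contr M1 (ltW hmu) MK).
  rewrite -vM; apply: ge0_le_integral => //.
  - by move=> x _; rewrite lee_fin (young_ge0 _ _ Y).
  - by apply: (measurable_young_abs _ _ _ Y) => //; exact: measurable_excess.
  - exact: (measurable_young_abs _ _ _ Y).
  - move=> x _; rewrite lee_fin (young_le _ _ Y)// ger0_norm ?excess_ge0//.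
    exact: excess_le.
have uleM := half u weak uM.
have NuleM : \forall x \ae lebesgue_rV n, Omega x -> - u x <= M.
  by apply: (half (\- u)); [exact: weak_solutionN|rewrite PhiN].
rewrite unlock /=; case: ifPn => _; last by rewrite lee_fin (le_trans _ M1).
apply/ess_supP; apply: filterS2 uleM NuleM => x uxM NuxM /=.
rewrite lee_fin patchE; case: ifPn => [|_]; last by rewrite normr0 (le_trans _ M1).
by rewrite inE => xO; rewrite ler_norml lerNl uxM ?NuxM.
Qed.
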